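(* Let $\mathcal M$ be a minimal time-like surface in $\mathbb R^n_1$ and $p\in\mathcal M$. Then the following conditions are equivalent: 1. The point $p$ is degenerate: ${\Phi'^{\bot}}^2(p)\in\mathbb D_0$. 2. For any orthonormal basis $(X_1,X_2)$ of $T_p(\mathcal M)$ with $X_1^2=-1$, $X_2^2=1$, the equality $\sigma(X_1,X_1)=\pm\sigma(X_1,X_2)$ holds (for one of the two signs). 3. There exists at least one orthonormal basis $(X_1,X_2)$ of $T_p(\mathcal M)$ with $X_1^2=-1$, $X_2^2=1$, for which $\sigma(X_1,X_1)=\pm\sigma(X_1,X_2)$ (for one of the two signs).
   Context: $\mathbb D=\{t=u+\mathrm j v:\ u,v\in\mathbb R\}$ with $\mathrm j^2=1$ is the algebra of double numbers; $|t|^2=t\bar t=u^2-v^2$; $\mathbb D_0=\{t\in\mathbb D:|t|^2=0\}$; $\frac{\partial}{\partial t}=\frac12\left(\frac{\partial}{\partial u}+\mathrm j\frac{\partial}{\partial v}\right)$. $\mathbb R^n_1$ is $\mathbb R^n$ with $a\cdot b=-a_1b_1+a_2b_2+\dots+a_nb_n$; $\mathbb D^n_1=\mathbb D^n$ with the $\mathbb D$-bilinear extension of this product; $a^2=a\cdot a$. A time-like surface $\mathcal M=(\mathcal D,\mathrm x)$ is given by a smooth immersion $\mathrm x(u,v):\mathcal D\to\mathbb R^n_1$ of a domain $\mathcal D\subset\mathbb R^2\cong\mathbb D$ ($t=u+\mathrm jv$) whose induced metric is indefinite. With $E=\mathrm x_u^2$, $F=\mathrm x_u\cdot\mathrm x_v$,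 $G=\mathrm x_v^2$, the coordinates are isothermal if $E=-G$, $F=0$; the standing convention is $E<0$. $a^\bot$ is the orthogonal projection of $a\in\mathbb D^n_1$ to the $\mathbb D$-linear span of the normal space $N_p(\mathcal M)$. The second fundamental form is $\sigma(X,Y)=(\nabla_XY)^\bot$ with $\nabla$ the canonical flat connection; $\mathrm H=\frac12(-\sigma(X_1,X_1)+\sigma(X_2,X_2))$ for an orthonormal tangent basis with $X_1^2=-1$, $X_2^2=1$. The surface is minimal if $\mathrm H=0$ everywhere. In isothermal coordinates, $\Phi=2\frac{\partial\mathrm x}{\partial t}=\mathrm x_u+\mathrm j\,\mathrm x_v$, $\Phi'=\frac{\partial\Phi}{\partial t}$, ${\Phi'^{\bot}}^2=\Phi'^\bot\cdot\Phi'^\bot$. A point $p$ of a minimal time-like surface given in isothermal coordinates is degenerate if ${\Phi'^{\bot}}^2(p)\in\mathbb D_0$ (this does not depend on the choice of isothermal coordinates). *)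

(* Defs.v *)
From HB Require Import structures.
From mathcomp Require Import all_boot all_order all_algebra.
From mathcomp Require Import all_classical all_reals all_analysis.
From mathcomp Require Import ring.

Set Implicit Arguments.
Unset Strict Implicit.
Unset Printing Implicit Defensive.
Import Order.TTheory GRing.Theory Num.Theory.
Import numFieldNormedType.Exports.
Local Open Scope classical_set_scope.
Local Open Scope ring_scope.

(* [Dnum u v] is the double number u + j v, with j^2 = 1. *)
Record dnum (R : Type) := Dnum { dre : R ; dim : R }.

Definition dnum_pair (R : Type) (t : dnum R) : R * R := (dre t, dim t).
Definition pair_dnum (R : Type) (p : R * R) : dnum R := Dnum p.1 p.2.

Lemma dnum_pairK (R : Type) : cancel (@dnum_pair R) (@pair_dnum R).
Proof. by case. Qed.

HB.instance Definition _ (R : eqType) :=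
  Equality.copy (dnum R) (can_type (@dnum_pairK R)).
HB.instance Definition _ (R : choiceType) :=
  Choice.copy (dnum R) (can_type (@dnum_pairK R)).

Section DoubleRing.
Variable R : comNzRingType.
Implicit Types t s : dnum R.

Definition dzero : dnum R := Dnum 0 0.
Definition done_ : dnum R := Dnum 1 0.
Definition dopp t : dnum R := Dnum (- dre t) (- dim t).
Definition dadd t s : dnum R := Dnum (dre t + dre s) (dim t + dim s).
Definition dmul t s : dnum R :=
  Dnum (dre t * dre s + dim t * dim s) (dre t * dim s + dim t * dre s).

Lemma daddA : associative dadd.
Proof. by move=> [a b] [c d] [e f]; rewrite /dadd /= !addrA. Qed.
Lemma daddC : commutative dadd.
Proof. by move=> [a b] [c d]; rewrite /dadd /= (addrC a) (addrC b). Qed.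
Lemma dadd0 : left_id dzero dadd.
Proof. by move=> [a b]; rewrite /dadd /= !add0r. Qed.
Lemma daddN : left_inverse dzero dopp dadd.
Proof. by move=> [a b]; rewrite /dadd /= !addNr. Qed.

HB.instance Definition _ :=
  GRing.isZmodule.Build (dnum R) daddA daddC dadd0 daddN.

Lemma dmulA : associative dmul.
Proof. by move=> [a b] [c d] [e f]; congr Dnum => /=; ring. Qed.
Lemma dmulC : commutative dmul.
Proof. by move=> [a b] [c d]; congr Dnum => /=; ring. Qed.
Lemma dmul1 : left_id done_ dmul.
Proof. by move=> [a b]; rewrite /dmul /= !mul1r !mul0r !addr0. Qed.
Lemma dmulDl : left_distributive dmul dadd.
Proof. by move=> [a b] [c d] [e f]; congr Dnum => /=; ring. Qed.
Lemma done_neq0 : done_ != dzero.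
Proof. by apply/eqP => -[] /eqP; rewrite oner_eq0. Qed.

HB.instance Definition _ :=
  GRing.Zmodule_isComNzRing.Build (dnum R) dmulA dmulC dmul1 dmulDl done_neq0.

Definition dnum_of (r : R) : dnum R := Dnum r 0.
Definition dj : dnum R := Dnum 0 1.
Definition dconj t : dnum R := Dnum (dre t) (- dim t).
Definition dsqnorm t : R := dre t ^+ 2 - dim t ^+ 2.

Lemma dj_sqr : dj * dj = 1.
Proof. by congr Dnum => /=; rewrite ?mulr0 ?mul0r ?mulr1 ?add0r ?addr0. Qed.

Lemma dsqnormE t : t * dconj t = dnum_of (dsqnorm t).
Proof.
by case: t => a b; rewrite /dsqnorm; congr Dnum => /=; ring.
Qed.

Definition D0 : set (dnum R) := [set t | dsqnorm t = 0].

End DoubleRing.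

(* -a_1 b_1 + a_2 b_2 + ... + a_n b_n: over [R] the product of R^n_1, over [dnum R]
   its bilinear extension to D^n_1.  The time-like coordinate has index 0. *)
Definition minkowski_mx (K : comNzRingType) (n : nat) : 'M[K]_n :=
  diag_mx (\row_(i < n) (if val i == 0%N then -1 else 1)).

Definition mdot (K : comNzRingType) (n : nat) (a b : 'rV[K]_n) : K :=
  (a *m minkowski_mx K n *m b^T) 0 0.

Lemma mdotE (K : comNzRingType) (n : nat) (a b : 'rV[K]_n) :
  mdot a b = \sum_(i < n) (if val i == 0%N then -1 else 1) * (a 0 i * b 0 i).
Proof.
rewrite /mdot mxE; apply: eq_bigr => i _; rewrite mul_mx_diag !mxE.
by rewrite mulrAC mulrC.
Qed.

Definition domain (R : realType) (D : set 'rV[R]_2) : Prop :=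
  [/\ open D, D !=set0 & connected D].

(* [Ck k D f] for [D] open: all iterated directional derivatives of [f] up to
   order [k] exist and are continuous on [D]. *)
Fixpoint Ck (R : realType) (V : normedModType R) (k : nat)
    (D : set 'rV[R]_2) (f : 'rV[R]_2 -> V) {struct k} : Prop :=
  if k is k'.+1 then
    (forall q, D q -> differentiable f q) /\
    (forall v : 'rV[R]_2, Ck k' D (fun q => 'D_v f q))
  else forall q, D q -> {for q, continuous f}.

Definition smooth (R : realType) (V : normedModType R)
    (D : set 'rV[R]_2) (f : 'rV[R]_2 -> V) : Prop :=
  forall k, Ck k D f.

Section Surface.
Variables (R : realType) (n : nat).
Implicit Types (D : set 'rV[R]_2) (x : 'rV[R]_2 -> 'rV[R]_n) (q : 'rV[R]_2).

Definition e_u : 'rV[R]_2 := delta_mx 0 0.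
Definition e_v : 'rV[R]_2 := delta_mx 0 1.

(* Points of the surface are identified with their parameters [q].  The rows
   of ['J x q] are x_u and x_v, so that the tangent space at [q] is the row
   space of ['J x q]. *)
Definition tangent x q (X : 'rV[R]_n) : bool := (X <= 'J x q)%MS.

Definition timelike_surface D x : Prop :=
  [/\ domain D,
      smooth D x,
      forall q, D q -> row_free ('J x q)
    & forall q, D q -> exists X Y : 'rV[R]_n,
        [/\ tangent x q X, tangent x q Y, mdot X X < 0 & 0 < mdot Y Y]].

Definition orthonormal_tangent_basis x q (X1 X2 : 'rV[R]_n) : Prop :=
  [/\ (col_mx X1 X2 == 'J x q)%MS,
      mdot X1 X1 = -1, mdot X2 X2 = 1 & mdot X1 X2 = 0].

(* The row space consists of the [a] orthogonal to x_u and x_v. *)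
Definition normal_mx x q : 'M[R]_n :=
  kermx (minkowski_mx R n *m ('J x q)^T).

(* Matrix of the projection onto the normal space along the tangent space. *)
Definition perp_mx x q : 'M[R]_n := proj_mx (normal_mx x q) <<'J x q>>%MS.

Definition perp x q (a : 'rV[R]_n) : 'rV[R]_n := a *m perp_mx x q.

(* The same matrix acts D-linearly on D^n, and projects onto the D-linear span
   of the normal space. *)
Definition dperp x q (a : 'rV[dnum R]_n) : 'rV[dnum R]_n :=
  a *m map_mx (@dnum_of R) (perp_mx x q).

(* The xi in R^2 such that dx(xi) = X, for X tangent at [q]. *)
Definition tcoord x q (X : 'rV[R]_n) : 'rV[R]_2 := X *m pinvmx ('J x q).

(* Flat derivative, along the tangent vector [X] at [q], of a vector field [Y]
   along the surface. *)
Definition nabla x q (X : 'rV[R]_n) (Y : 'rV[R]_2 -> 'rV[R]_n) : 'rV[R]_n :=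
  'D_(tcoord x q X) Y q.

(* The tangent vector [Y] at [q] is extended to the tangent vector field having
   constant components in the frame (x_u, x_v); another extension changes
   nabla_X Y by a tangent vector only. *)
Definition sff x q (X Y : 'rV[R]_n) : 'rV[R]_n :=
  perp x q (nabla x q X (fun q' => tcoord x q Y *m 'J x q')).

(* The mean curvature vector does not depend on the orthonormal basis. *)
Definition is_mean_curvature x q (H : 'rV[R]_n) : Prop :=
  exists X1 X2 : 'rV[R]_n, orthonormal_tangent_basis x q X1 X2 /\
    H = 2^-1 *: (- sff x q X1 X1 + sff x q X2 X2).

Definition minimal D x : Prop := forall q, D q -> is_mean_curvature x q 0.

Definition isothermal D x : Prop := forall q, D q ->
  let E := mdot ('D_e_u x q) ('D_e_u x q) in
  let F := mdot ('D_e_u x q) ('D_e_v x q) in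
  let G := mdot ('D_e_v x q) ('D_e_v x q) in
  [/\ E = - G, F = 0 & E < 0].

(* [psi] is a diffeomorphism of the domain [D'] onto an open subset of [D]. *)
Definition local_reparametrization D (D' : set 'rV[R]_2)
    (psi : 'rV[R]_2 -> 'rV[R]_2) : Prop :=
  [/\ domain D', smooth D' psi &
      exists (U : set 'rV[R]_2) (phi : 'rV[R]_2 -> 'rV[R]_2),
        [/\ open U /\ U `<=` D, smooth U phi,
            forall s, D' s -> U (psi s) /\ phi (psi s) = s
          & forall q, U q -> D' (phi q) /\ psi (phi q) = q]].

Definition dderive (v : 'rV[R]_2) (f : 'rV[R]_2 -> 'rV[dnum R]_n) q :
    'rV[dnum R]_n :=
  map2_mx (@Dnum R) ('D_v (fun s => map_mx (@dre R) (f s)) q)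
                    ('D_v (fun s => map_mx (@dim R) (f s)) q).

Definition d_dt (f : 'rV[R]_2 -> 'rV[dnum R]_n) q : 'rV[dnum R]_n :=
  dnum_of 2^-1 *: (dderive e_u f q + dj R *: dderive e_v f q).

Definition Phi x q : 'rV[dnum R]_n :=
  2 *: d_dt (fun s => map_mx (@dnum_of R) (x s)) q.

Lemma PhiE x q : Phi x q = map2_mx (@Dnum R) ('D_e_u x q) ('D_e_v x q).
Proof.
have hre : (fun s => map_mx (@dre R) (map_mx (@dnum_of R) (x s))) = x.
  by apply/funext => s; apply/matrixP => i j; rewrite !mxE.
have him : (fun s => map_mx (@dim R) (map_mx (@dnum_of R) (x s))) = cst 0.
  by apply/funext => s; apply/matrixP => i j; rewrite !mxE.
have h2 : (2 : dnum R) * dnum_of 2^-1 = 1.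
  by congr Dnum => /=; rewrite !(addr0, mulr0, mul0r) // divff ?pnatr_eq0.
rewrite /Phi /d_dt scalerA h2 scale1r /dderive hre him !derive_cst.
apply/matrixP => i j; rewrite !mxE.
by congr Dnum => /=; rewrite !(mul0r, mul1r, addr0, add0r).
Qed.

Definition Phi' x q : 'rV[dnum R]_n := d_dt (Phi x) q.

Definition degenerate x q : Prop :=
  D0 (mdot (dperp x q (Phi' x q)) (dperp x q (Phi' x q))).

End Surface.

(* Main.v *)
Require Import Defs.
From mathcomp Require Import all_boot all_order all_algebra.
From mathcomp Require Import all_classical all_reals all_analysis.
From mathcomp Require Import ring lra.
Set Implicit Arguments.
Unset Strict Implicit.
Unset Printing Implicit Defensive.
Import Order.TTheory GRing.Theory Num.Theory.
Import numFieldNormedType.Exports.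
Local Open Scope classical_set_scope.
Local Open Scope ring_scope.

(** Minimality means sigma(X1,X1) = sigma(X2,X2) for every orthonormal basis.  In
    isothermal coordinates X1 and X2 can be taken proportional to x_u and x_v by
    the same factor; then Phi'^perp is proportional to
    sigma(X1,X1) + j sigma(X1,X2).  If A and B are the two normal vectors, then
    |(A + j B)^2|^2 = (A^2 + B^2)^2 - (2 A.B)^2 = (A - B)^2 (A + B)^2, and it
    vanishes iff A = B or A = -B because the normal space is positive definite.
    Under a change of orthonormal basis the pair (A, B) undergoes a hyperbolic
    rotation, possibly with a change of the sign of B, so that the condition
    A = B or A = -B does not depend on the basis.  Symmetry of sigma is the
    symmetry of second derivatives. *)

(** * Second derivatives *)

Lemma is_derive_line (R : realType) (V W : normedModType R) (f : V -> W)
    (a v : V) (t : R) :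
  derivable f (t *: v + a) v ->
  is_derive t 1 (fun s : R => f (s *: v + a)) ('D_v f (t *: v + a)).
Proof.
have E : (fun h : R => h^-1 *: (((fun s : R => f (s *: v + a)) \o shift t)
           (h *: 1) - f (t *: v + a))) =
         (fun h : R => h^-1 *: ((f \o shift (t *: v + a)) (h *: v)
           - f (t *: v + a))).
  by apply/funext => h /=; rewrite [h *: 1]mulr1 scalerDl addrA.
by move=> df; split; rewrite /derivable /derive E.
Qed.

Lemma MVT_from0 (R : realType) (f df : R -> R) (h : R) :
  0 < h -> (forall s, 0 <= s <= h -> is_derive s 1 f (df s)) ->
  exists2 s, 0 <= s <= h & f h - f 0 = df s * h.
Proof.
move=> h0 fdf.
have [s sh|s sh|s sh E] := @MVT R f df 0 h h0.
- by apply: fdf; move: sh; rewrite in_itv/= => /andP[/ltW-> /ltW->].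
- move: sh; apply: derivable_within_continuous => {}s.
  by rewrite in_itv/= => /fdf/@ex_derive.
- exists s; last by rewrite E subr0.
  by move: sh; rewrite in_itv/= => /andP[/ltW-> /ltW->].
Qed.

(** The mean value theorem is applied twice: along [u] to the difference of [f] across the step
    [h *: v], then along [v] to ['D_u f]. *)
Lemma second_difference (R : realType) (V : normedModType R) (f : V -> R)
    (p u v : V) (h : R) :
  0 < h ->
  (forall s t : R, 0 <= s <= h -> 0 <= t <= h ->
     derivable f (s *: u + (t *: v + p)) u /\
     derivable ('D_u f) (t *: v + (s *: u + p)) v) ->
  exists s t : R, [/\ 0 <= s <= h, 0 <= t <= h &
    f (h *: u + (h *: v + p)) - f (h *: u + p) - f (h *: v + p) + f p =
    'D_v ('D_u f) (t *: v + (s *: u + p)) * h ^+ 2].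
Proof.
move=> h0 df.
have hh : 0 <= h <= h by rewrite lexx ltW.
have h00 : 0 <= (0 : R) <= h by rewrite lexx ltW.
pose g (s : R) := f (s *: u + (h *: v + p)) - f (s *: u + p).
have dg s : 0 <= s <= h -> is_derive s 1 g
    ('D_u f (s *: u + (h *: v + p)) - 'D_u f (s *: u + p)).
  move=> sh; apply: is_deriveB; apply: is_derive_line.
    exact: (df s h sh hh).1.
  by have := (df s 0 sh h00).1; rewrite scale0r add0r.
have [s sh gE] := MVT_from0 h0 dg.
pose k (t : R) := 'D_u f (t *: v + (s *: u + p)).
have [t th|t th kE] := @MVT_from0 R k
  (fun t => 'D_v ('D_u f) (t *: v + (s *: u + p))) h h0.
  by apply: is_derive_line; exact: (df s t sh th).2.
exists s, t; split=> //; rewrite expr2 mulrA -kE /k scale0r add0r.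
rewrite (addrCA (h *: v)) -gE /g scale0r !add0r; ring.
Qed.

(** The second difference over the parallelogram with sides [h *: u] and [h *: v] is symmetric in
    [u] and [v]. Divided by [h ^+ 2], it is a value of each mixed derivative near [p], so continuity
    at [p] makes the two limits agree. *)
Lemma schwarz_scalar (R : realType) (V : normedModType R) (f : V -> R)
    (p u v : V) :
  (\forall q \near p, [/\ derivable f q u, derivable f q v,
     derivable ('D_u f) q v & derivable ('D_v f) q u]) ->
  {for p, continuous ('D_v ('D_u f))} -> {for p, continuous ('D_u ('D_v f))} ->
  'D_v ('D_u f) p = 'D_u ('D_v f) p.
Proof.
move=> df cvu cuv; apply/eqP; rewrite -subr_eq0 -normr_le0.
apply/ler_addgt0Pr => e e0; rewrite add0r.
have e20 : 0 < e / 2 by rewrite divr_gt0.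
move/cvgrPdist_le : cvu => /(_ _ e20) cvu.
move/cvgrPdist_le : cuv => /(_ _ e20) cuv.
have [r r0 Hr] : exists2 r, 0 < r & forall q, `|q - p| < r ->
    [/\ [/\ derivable f q u, derivable f q v, derivable ('D_u f) q v &
      derivable ('D_v f) q u],
      `|'D_v ('D_u f) p - 'D_v ('D_u f) q| <= e / 2 &
      `|'D_u ('D_v f) p - 'D_u ('D_v f) q| <= e / 2].
  have [r /= r0 Hr] := (nbhs_normP p _).1 (filterI df (filterI cvu cuv)).
  exists r; first exact: r0.
  move=> q; rewrite distrC => qr.
  by have [H1 [H2 H3]] := Hr q qr; split; [exact: H1|exact: H2|exact: H3].
(* The summand 1 keeps [c] positive when [u] and [v] vanish; with [h * c = r / 2] the whole
   parallelogram lies in the ball of radius [r]. *)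
pose c := `|u| + `|v| + 1.
have c0 : 0 < c by rewrite ltr_wpDl ?addr_ge0.
pose h := r / 2 / c.
have h0 : 0 < h by rewrite !divr_gt0.
have near_p (s t : R) : 0 <= s <= h -> 0 <= t <= h ->
    `|s *: u + (t *: v + p) - p| < r.
  move=> /andP[s0 sh] /andP[t0 th]; rewrite addrA addrK.
  rewrite (le_lt_trans (ler_normD _ _))// !normrZ !ger0_norm//.
  have : s * `|u| + t * `|v| <= h * `|u| + h * `|v|.
    by rewrite lerD// ler_wpM2r.
  have : h * c = r / 2 by rewrite /h divfK ?gt_eqF.
  rewrite /c !mulrDr; lra.
have [|s [t [sh th E1]]] := @second_difference R V f p u v h h0.
  move=> s t sh th; have [[d1 _ d3 _] _ _] := Hr _ (near_p s t sh th).
  by split; [exact: d1|rewrite addrCA; exact: d3].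
have [|s' [t' [sh' th' E2]]] := @second_difference R V f p v u h h0.
  move=> a b ah bh; have [[_ d2 _ d4] _ _] := Hr _ (near_p b a bh ah).
  by split; [rewrite addrCA; exact: d2|exact: d4].
have E : 'D_v ('D_u f) (t *: v + (s *: u + p)) =
         'D_u ('D_v f) (t' *: u + (s' *: v + p)).
  apply: (@mulIf _ (h ^+ 2)); first by rewrite expf_neq0 ?gt_eqF.
  apply: etrans (esym E1) (etrans _ E2).
  by rewrite (addrCA (h *: v)) [X in X + _]addrAC.
have [_ l1 _] := Hr _ (near_p s t sh th).
have [_ _ l2] := Hr _ (near_p t' s' th' sh').
rewrite addrCA E in l1.
rewrite -(subrKA ('D_u ('D_v f) (t' *: u + (s' *: v + p)))).
apply: le_trans (ler_normD _ _) _; rewrite (splitr e).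
by apply: lerD; [exact: l1|rewrite distrC; exact: l2].
Qed.

(** * Coordinatewise derivatives and chain rules for vector-valued maps *)

Lemma derivable_coord (R : realType) (V : normedModType R) (m n : nat)
    (f : V -> 'M[R]_(m, n)) (q v : V) i j :
  derivable f q v -> derivable (fun s => f s i j) q v.
Proof. by move/derivable_mxP. Qed.

Lemma derive_coord (R : realType) (V : normedModType R) (m n : nat)
    (f : V -> 'M[R]_(m, n)) (q v : V) i j :
  derivable f q v -> 'D_v (fun s => f s i j) q = 'D_v f q i j.
Proof. by move=> df; rewrite derive_mx// mxE. Qed.

Lemma is_derive_scale (R : realType) (V : normedModType R) (m n : nat)
    (k : V -> R) (f : V -> 'M[R]_(m, n)) (q v : V) :
  derivable k q v -> derivable f q v ->
  is_derive q v (fun s => k s *: f s) ('D_v k q *: f q + k q *: 'D_v f q).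
Proof.
move=> dk df; have dij i j : is_derive q v (fun s => (k s *: f s) i j)
    (('D_v k q *: f q + k q *: 'D_v f q) i j).
  have -> : (fun s => (k s *: f s) i j) = (k * (fun s => f s i j)).
    by apply/funext => s; rewrite mxE.
  have /derivableP := (derivable_mxP f q v).1 df i j.
  rewrite (derive_coord _ _ df) => dfij.
  apply: (@is_derive_eq _ _ _ _ _ _ _ _ (is_deriveM (derivableP dk) dfij)).
  by rewrite !mxE addrC; congr (_ + _); exact: mulrC.
have dkf : derivable (fun s => k s *: f s) q v.
  by apply/derivable_mxP => a b; exact: (@ex_derive _ _ _ _ _ _ _ (dij a b)).
split=> //; apply/matrixP => a b; rewrite -(derive_coord _ _ dkf).
exact: (@derive_val _ _ _ _ _ _ _ (dij a b)).
Qed.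

Lemma derive_comp (R : realType) (U V W : normedModType R) (g : U -> V)
    (f : V -> W) (q w : U) :
  differentiable g q -> differentiable f (g q) ->
  'D_w (f \o g) q = 'D_('D_w g q) f (g q).
Proof.
move=> dg df; have dfg : differentiable (f \o g) q by exact: differentiable_comp.
by rewrite (deriveE _ dfg) diff_comp// (deriveE _ dg) (deriveE _ df).
Qed.

Lemma open_near (T : topologicalType) (D : set T) (q : T) :
  open D -> D q -> \forall s \near q, D s.
Proof. by move=> oD Dq; exact: open_nbhs_nbhs. Qed.

Section SecondDerivative.
Variables (R : realType) (n : nat) (D : set 'rV[R]_2).
Variables (f : 'rV[R]_2 -> 'rV[R]_n).
Hypotheses (oD : open D) (f2 : Ck 2 D f).

(** Reduction to the coordinates of [f]. Taking a coordinate commutes with differentiation at points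
    of [D], and [D] is open, so the exchange can be repeated for the second derivative by equality
    near each point. *)
Lemma schwarz (p u v : 'rV[R]_2) : D p -> 'D_v ('D_u f) p = 'D_u ('D_v f) p.
Proof.
have [df df1] := f2.
have df' w q : D q -> differentiable ('D_w f) q by case: (df1 w) => + _; exact.
have cf w w' q : D q -> {for q, continuous ('D_w' ('D_w f))}.
  by move=> Dq; exact: (df1 w).2 w' q Dq.
move=> Dp; apply/matrixP => i j.
have D1 w q : D q -> 'D_w (fun s => f s i j) q = 'D_w f q i j.
  by move=> Dq; apply/derive_coord/diff_derivable/df.
have D1' w w' q : D q -> derivable ('D_w (fun s => f s i j)) q w'.
  move=> Dq; apply: (@near_eq_derivable _ _ _ (fun s => 'D_w f s i j)).
    by apply: filterS (open_near oD Dq) => s /(D1 w).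
  exact/derivable_coord/diff_derivable/df'.
have D2 w w' q : D q ->
    'D_w' ('D_w (fun s => f s i j)) q = 'D_w' ('D_w f) q i j.
  move=> Dq; rewrite -derive_coord; last exact/diff_derivable/df'.
  by apply: near_eq_derive; apply: filterS (open_near oD Dq) => s /(D1 w).
have C w w' : {for p, continuous ('D_w' ('D_w (fun s => f s i j)))}.
  rewrite /prop_for /continuous_at D2//.
  have : 'D_w' ('D_w f) s i j @[s --> p] --> 'D_w' ('D_w f) p i j.
    apply: (@continuous_comp _ _ _ ('D_w' ('D_w f)) (fun M : 'rV[R]_n => M i j)).
      exact: cf.
    exact: coord_continuous.
  apply: cvg_trans.
  have E : {near nbhs p, (fun s => 'D_w' ('D_w f) s i j) =1
                         'D_w' ('D_w (fun s => f s i j))}.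
    by apply: filterS (open_near oD Dp) => s Ds; rewrite D2.
  exact: near_eq_cvg E.
apply: etrans (esym (D2 u v p Dp)) _; apply: etrans (D2 v u p Dp).
apply: schwarz_scalar; [|exact: C|exact: C].
apply: filterS (open_near oD Dp) => q Dq.
by split; [| |exact: D1'|exact: D1']; exact/derivable_coord/diff_derivable/df.
Qed.

Lemma derive2Dr (p w u v : 'rV[R]_2) (a : R) : D p ->
  'D_(a *: u + v) ('D_w f) p = a *: 'D_u ('D_w f) p + 'D_v ('D_w f) p.
Proof.
move=> Dp; have dw : differentiable ('D_w f) p by case: (f2.2 w) => + _; exact.
by rewrite !(deriveE _ dw) linearP.
Qed.

(** The field being differentiated is the constant-component extension used in [sff], which thereby
    becomes the normal part of a second derivative. *)
Lemma derive_jacobian (p w v : 'rV[R]_2) : D p ->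
  'D_w (fun q => v *m 'J f q) p = 'D_w ('D_v f) p.
Proof.
move=> Dp; apply: near_eq_derive; apply: filterS (open_near oD Dp) => q Dq.
by rewrite deriveEjacobian//; exact: f2.1.
Qed.

(** The first term on the right is a combination of the rows of the Jacobian, hence tangent: the
    normal projection will remove it. *)
Lemma derive2_comp (D' : set 'rV[R]_2) (g : 'rV[R]_2 -> 'rV[R]_2)
    (s w w' : 'rV[R]_2) :
  open D' -> Ck 2 D' g -> (forall q, D' q -> D (g q)) -> D' s ->
  'D_w' ('D_w (f \o g)) s =
    'D_w' ('D_w g) s *m 'J f (g s) + 'D_('D_w' g s) ('D_('D_w g s) f) (g s).
Proof.
move=> oD' g2 gD D's; have Dgs := gD s D's.
have dw v q : D q -> differentiable ('D_v f) q.
  by case: (f2.2 v) => + _; exact.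
have dgw : differentiable ('D_w g) s by case: (g2.2 w) => + _; exact.
have sumE (c : 'rV[R]_2) (q : 'rV[R]_2) : D q ->
    c *m 'J f q = \sum_i c 0 i *: 'D_(delta_mx 0 i) f q.
  move=> Dq; rewrite {1}(row_sum_delta c) mulmx_suml; apply: eq_bigr => i _.
  by rewrite -scalemxAl deriveEjacobian//; exact: f2.1.
(* Expanding the moving direction ['D_w g q] in the standard basis leaves scalar coefficients times
   fixed directional derivatives, to which the product rule applies. *)
transitivity ('D_w' (fun q => \sum_i ('D_w g q 0 i) *:
    ('D_(delta_mx 0 i) f \o g) q) s).
  apply: near_eq_derive; apply: filterS (open_near oD' D's) => q D'q.
  rewrite derive_comp; [|exact: g2.1|exact: f2.1 (gD q D'q)].
  rewrite deriveEjacobian; last exact: f2.1 (gD q D'q).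
  by rewrite sumE//; exact: gD.
have dterm i : is_derive s w' (fun q => ('D_w g q 0 i) *:
    ('D_(delta_mx 0 i) f \o g) q)
    ('D_w' ('D_w g) s 0 i *: 'D_(delta_mx 0 i) f (g s) +
     'D_w g s 0 i *: 'D_(delta_mx 0 i) ('D_('D_w' g s) f) (g s)).
  (* The order of differentiation is exchanged so that the basis direction is outermost and the sum
     over [i] reassembles by linearity. *)
  rewrite -schwarz// -derive_comp; [|exact: g2.1|exact: dw].
  rewrite -derive_coord; last exact: diff_derivable.
  apply: is_derive_scale.
    exact/derivable_coord/diff_derivable.
  apply/diff_derivable/differentiable_comp; [exact: g2.1|exact: dw].
have -> : (fun q => \sum_i 'D_w g q 0 i *: ('D_(delta_mx 0 i) f \o g) q) =
    \sum_i (fun q => 'D_w g q 0 i *: ('D_(delta_mx 0 i) f \o g) q).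
  by apply/funext => q; rewrite fct_sumE.
rewrite (@derive_val _ _ _ _ _ _ _ (is_derive_sum dterm)) big_split/= sumE//.
congr (_ + _); rewrite -[in RHS]schwarz// [RHS]deriveEjacobian; last exact: dw.
rewrite [in RHS](row_sum_delta ('D_w g s)) mulmx_suml; apply: eq_bigr => i _.
by rewrite -scalemxAl (deriveEjacobian _ (dw _ _ Dgs)).
Qed.

End SecondDerivative.

(** * Minkowski geometry of the tangent plane *)

Section Mdot.
Variables (K : comNzRingType) (n : nat).
Implicit Types a b c : 'rV[K]_n.

Lemma mdotC a b : mdot a b = mdot b a.
Proof. by rewrite !mdotE; apply: eq_bigr => i _; rewrite (mulrC (a 0 i)). Qed.

Lemma mdotDl a b c : mdot (a + b) c = mdot a c + mdot b c.
Proof. by rewrite /mdot !mulmxDl mxE. Qed.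

Lemma mdotZl k a b : mdot (k *: a) b = k * mdot a b.
Proof. by rewrite /mdot -!scalemxAl mxE. Qed.

Lemma mdotDr a b c : mdot a (b + c) = mdot a b + mdot a c.
Proof. by rewrite mdotC mdotDl !(mdotC a). Qed.

Lemma mdotZr k a b : mdot a (k *: b) = k * mdot a b.
Proof. by rewrite mdotC mdotZl mdotC. Qed.

Lemma mdotNl a b : mdot (- a) b = - mdot a b.
Proof. by rewrite -scaleN1r mdotZl mulN1r. Qed.

Lemma mdotNr a b : mdot a (- b) = - mdot a b.
Proof. by rewrite mdotC mdotNl mdotC. Qed.

Definition mdot_simp := (mdotDl, mdotDr, mdotNl, mdotNr, mdotZl, mdotZr).

End Mdot.

(* If e is the time-like vector, then e_0 w - w_0 e lies in the Euclidean
   hyperplane of vanishing time coordinate and has square e_0^2 w^2 + w_0^2 e^2. *)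
Lemma mdot_normal_eq0 (R : realType) (n : nat) (e w : 'rV[R]_n) :
  mdot e e < 0 -> mdot w e = 0 -> mdot w w = 0 -> w = 0.
Proof.
have space (m : nat) (z : 'rV[R]_m.+1) : z 0 0 = 0 ->
    0 <= mdot z z /\ (mdot z z = 0 -> z = 0).
  move=> z0; have -> : mdot z z = \sum_i z 0 i ^+ 2.
    rewrite mdotE; apply: eq_bigr => i _; case: eqP => [i0|]; last by rewrite mul1r.
    by have -> : i = 0 by [exact/val_inj]; rewrite z0 expr2 !mulr0.
  split=> [|/eqP]; first by apply: sumr_ge0 => i _; exact: sqr_ge0.
  rewrite psumr_eq0 => [/allP zi|i _]; last exact: sqr_ge0.
  apply/rowP => i; rewrite mxE; apply/eqP; rewrite -sqrf_eq0.
  exact: zi (mem_index_enum i).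
case: n e w => [|m] e w e0 we ww; first by apply/rowP => -[].
have /space[+ _] : (e 0 0 *: w - w 0 0 *: e) 0 0 = 0.
  by rewrite !mxE mulrC subrr.
rewrite !mdot_simp ww (mdotC e) we !mulr0 !oppr0 !add0r opprK => we0.
(* The product of the square of the time coordinate of [w] with the negative number [mdot e e] is
   nonnegative, so that coordinate vanishes and [w] itself lies in the Euclidean hyperplane. *)
suff /space[_] : w 0 0 = 0 by apply.
apply/eqP; rewrite -sqrf_eq0 eq_le sqr_ge0 andbT expr2.
by rewrite -(nmulr_rge0 _ e0) mulrC -mulrA.
Qed.

Section Basis.
Variables (R : realType) (n : nat) (x : 'rV[R]_2 -> 'rV[R]_n) (p : 'rV[R]_2).
Variables X1 X2 : 'rV[R]_n.
Hypothesis bX : orthonormal_tangent_basis x p X1 X2.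

Lemma tangent_basis : tangent x p X1 /\ tangent x p X2.
Proof.
have [/eqmxP eJ _ _ _] := bX.
by rewrite /tangent -!eJ -!addsmxE addsmxSl addsmxSr.
Qed.

Lemma tangent_coords X : tangent x p X ->
  exists a b : R, X = a *: X1 + b *: X2.
Proof.
have [/eqmxP eJ _ _ _] := bX; rewrite /tangent -eJ => /submxP[c ->].
exists (lsubmx c 0 0), (rsubmx c 0 0).
rewrite -{1}(hsubmxK c) mul_row_col.
by rewrite {1}(mx11_scalar (lsubmx c)) {1}(mx11_scalar (rsubmx c)) !mul_scalar_mx.
Qed.

Lemma normalP w :
  (w <= normal_mx x p)%MS <-> mdot w X1 = 0 /\ mdot w X2 = 0.
Proof.
have [/eqmxP eJ _ _ _] := bX; split=> [/sub_kermxP wJ|[w1 w2]].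
  have wX X : tangent x p X -> mdot w X = 0.
    move=> /submxP[c ->]; rewrite /mdot trmx_mul mulmxA -(mulmxA w) wJ.
    by rewrite mul0mx mxE.
  by split; apply: wX; have [] := tangent_basis.
apply/sub_kermxP; have /submxP[c ->] : ('J x p <= col_mx X1 X2)%MS by rewrite eJ.
rewrite trmx_mul tr_col_mx !mulmxA mul_mx_row.
rewrite [w *m _ *m X1^T]mx11_scalar [w *m _ *m X2^T]mx11_scalar.
by rewrite -!/(mdot _ _) w1 w2 raddf0 row_mx0 mul0mx.
Qed.

(** The plus sign reflects that [X1] has square -1. The formula sees the surface only through the
    basis, so two parametrizations sharing a basis have the same projection. *)
Lemma perpE a : perp x p a = a + mdot a X1 *: X1 - mdot a X2 *: X2.
Proof.
have [/eqmxP eJ n1 n2 n12] := bX; have [t1 t2] := tangent_basis.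
set w := RHS; have wN : (w <= normal_mx x p)%MS.
  by apply/normalP; rewrite /w !mdot_simp (mdotC X2) n1 n2 n12; split; ring.
pose t := - (mdot a X1 *: X1) + mdot a X2 *: X2.
have -> : a = w + t by apply/rowP => i; rewrite /w /t !mxE; ring.
have tT : (t <= <<'J x p>>)%MS.
  by rewrite genmxE addmx_sub ?eqmx_opp ?scalemx_sub.
(* [proj_mx] behaves as a projection only for a direct sum; here directness is the nondegeneracy of
   the form on the tangent plane. *)
have dis : (normal_mx x p :&: <<'J x p>> = 0)%MS.
  apply/eqP; rewrite -submx0; apply/rV_subP => v; rewrite sub_capmx genmxE.
  move=> /andP[/normalP[v1 v2] /tangent_coords[b [c vE]]].
  move: v1 v2; rewrite vE.
  rewrite !mdot_simp (mdotC X2) n1 n2 n12 !mulr0 add0r addr0 mulr1 mulrN1.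
  by move=> /eqP; rewrite oppr_eq0 => /eqP-> ->; rewrite !scale0r addr0 sub0mx.
rewrite /perp /perp_mx mulmxDl (proj_mx_id dis wN) (proj_mx_0 dis tT).
by rewrite addr0.
Qed.

Lemma perp_tangent X : tangent x p X -> perp x p X = 0.
Proof.
have [_ n1 n2 n12] := bX.
move=> /tangent_coords[a [b ->]]; rewrite perpE !mdot_simp (mdotC X2) n1 n2 n12.
by apply/rowP => i; rewrite !mxE; ring.
Qed.

Lemma perp_normal a : mdot (perp x p a) X1 = 0 /\ mdot (perp x p a) X2 = 0.
Proof. by apply/normalP; exact: proj_mx_sub. Qed.

Lemma perp_isotropic a : mdot (perp x p a) (perp x p a) = 0 -> perp x p a = 0.
Proof.
have [_ n1 _ _] := bX; have [w1 _] := perp_normal a.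
by apply: mdot_normal_eq0 w1; rewrite n1 ltrN10.
Qed.

(** Up to sign, [a] and [b] are a hyperbolic cosine and sine; the sign [e] records whether the
    change preserves orientation when [a] and [b] are fixed by [Y1]. *)
Lemma orthonormal_basis_change Y1 Y2 : orthonormal_tangent_basis x p Y1 Y2 ->
  exists a b e : R, [/\ a ^+ 2 = 1 + b ^+ 2, e ^+ 2 = 1,
    Y1 = a *: X1 + b *: X2 & Y2 = e *: (b *: X1 + a *: X2)].
Proof.
move=> bY; have [_ n1 n2 n12] := bX.
have n21 : mdot X2 X1 = 0 by rewrite mdotC.
have [eY m1 m2 m12] := bY.
have tY Y : tangent x p Y -> exists a b : R, Y = a *: X1 + b *: X2.
  exact: tangent_coords.
have sJ Y : (Y <= col_mx Y1 Y2)%MS -> tangent x p Y.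
  by rewrite /tangent (eqmxP eY).
have [a [b Ea]] : exists a b : R, Y1 = a *: X1 + b *: X2.
  by apply/tY/sJ; rewrite -addsmxE addsmxSl.
have [c [d Ec]] : exists c d : R, Y2 = c *: X1 + d *: X2.
  by apply/tY/sJ; rewrite -addsmxE addsmxSr.
move: m1 m2 m12; rewrite Ea Ec !mdot_simp n1 n2 n12 n21 => m1 m2 m12.
have ab : a ^+ 2 = 1 + b ^+ 2 by lra.
have cd : d ^+ 2 = 1 + c ^+ 2 by lra.
have acbd : a * c = b * d by lra.
(* Squaring the orthogonality relation gives [(1 + b ^+ 2) * c ^+ 2 = b ^+ 2 * (1 + c ^+ 2)]. *)
have bc : b ^+ 2 = c ^+ 2.
  have : (a * c) ^+ 2 = (b * d) ^+ 2 by rewrite acbd.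
  by rewrite !exprMn ab cd => ?; lra.
have ad : a ^+ 2 = d ^+ 2 by rewrite ab cd bc.
have a0 : a != 0.
  by apply/eqP => a0; move: ab (sqr_ge0 b); rewrite a0 expr0n /=; lra.
exists a, b, (d / a); split=> //.
  by rewrite expr_div_n -ad divff// expf_neq0.
have -> : c = d / a * b.
  by apply: (mulfI a0); rewrite acbd; field.
by rewrite scalerDr !scalerA divfK.
Qed.

End Basis.

(** * The second fundamental form and changes of orthonormal basis *)

Section SecondFundamentalForm.
Variables (R : realType) (n : nat) (D : set 'rV[R]_2).
Variables (x : 'rV[R]_2 -> 'rV[R]_n) (p : 'rV[R]_2).
Hypotheses (oD : open D) (x2 : Ck 2 D x) (Dp : D p).
Implicit Types X Y Z : 'rV[R]_n.

Lemma sffE X Y : sff x p X Y =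
  perp x p ('D_(tcoord x p X) ('D_(tcoord x p Y) x) p).
Proof. by rewrite /sff /nabla (derive_jacobian oD x2). Qed.

Lemma sffC X Y : sff x p X Y = sff x p Y X.
Proof.
apply: etrans (sffE X Y) _; apply: etrans (esym (sffE Y X)).
exact: (congr1 (perp x p) (schwarz oD x2 (tcoord x p Y) (tcoord x p X) Dp)).
Qed.

Lemma sffPl a X Y Z :
  sff x p (a *: X + Y) Z = a *: sff x p X Z + sff x p Y Z.
Proof.
rewrite !sffE /tcoord mulmxDl -scalemxAl (derive2Dr x2)//.
by rewrite /perp mulmxDl -scalemxAl.
Qed.

Lemma sff_lincomb a b c d X Y :
  sff x p (a *: X + b *: Y) (c *: X + d *: Y) =
  (a * c) *: sff x p X X + (a * d + b * c) *: sff x p X Y +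
  (b * d) *: sff x p Y Y.
Proof.
have s0 Z : sff x p 0 Z = 0.
  by rewrite sffE /tcoord mul0mx derive0 /perp mul0mx.
have sZ k Z W : sff x p (k *: Z) W = k *: sff x p Z W.
  by rewrite -[k *: Z]addr0 sffPl s0 addr0.
rewrite sffPl sZ !(sffC _ (c *: X + d *: Y)) !sffPl !sZ (sffC Y X).
move: (sff x p X X) (sff x p X Y) (sff x p Y Y) => P Q S.
by apply/rowP => i; rewrite !mxE; ring.
Qed.

Lemma sffZZ k X Y : sff x p (k *: X) (k *: Y) = (k * k) *: sff x p X Y.
Proof.
have := sff_lincomb k 0 0 k X Y.
by rewrite !(mulr0, mul0r, addr0, add0r, scale0r).
Qed.

Lemma sffZZ_eq k X Y Z W : k != 0 ->
  sff x p (k *: X) (k *: Y) = sff x p (k *: Z) (k *: W) <->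
  sff x p X Y = sff x p Z W.
Proof.
move=> k0; rewrite !sffZZ; split=> [|->//].
exact/scalerI/(mulf_neq0 k0 k0).
Qed.

Lemma sffZZ_eqN k X Y Z W : k != 0 ->
  sff x p (k *: X) (k *: Y) = - sff x p (k *: Z) (k *: W) <->
  sff x p X Y = - sff x p Z W.
Proof.
move=> k0; rewrite !sffZZ -scalerN; split=> [|->//].
exact/scalerI/(mulf_neq0 k0 k0).
Qed.

(** The combination is the normal projection of a single vector, so [perp_isotropic] applies; the
    values 1 and -1 of [t] serve for A + B and A - B. *)
Lemma sff_lincomb_isotropic X1 X2 (bX : orthonormal_tangent_basis x p X1 X2)
    t X Y Z W :
  let N := sff x p X Y + t *: sff x p Z W in mdot N N = 0 -> N = 0.
Proof.
rewrite /= !sffE /perp scalemxAl -mulmxDl -/(perp x p _).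
exact: perp_isotropic bX _.
Qed.

(** With A the common diagonal value and B the mixed one, both new diagonal values equal (a^2 + b^2)
    A + 2ab B, the second up to the factor e^2 = 1. Thus minimality, stated for some basis, becomes
    available in every basis. *)
Lemma sff_eq_diag X1 X2 Y1 Y2 :
  orthonormal_tangent_basis x p X1 X2 -> orthonormal_tangent_basis x p Y1 Y2 ->
  sff x p X2 X2 = sff x p X1 X1 -> sff x p Y2 Y2 = sff x p Y1 Y1.
Proof.
move=> bX bY E; have [a [b [e [_ e1 -> ->]]]] := orthonormal_basis_change bX bY.
rewrite scalerDr !scalerA !sff_lincomb E.
move: (sff x p X1 X1) (sff x p X1 X2) => P Q; apply/rowP => i; rewrite !mxE.
transitivity (e ^+ 2 * (a * a * P 0 i + (a * b + b * a) * Q 0 i + b * b * P 0 i)).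
  by ring.
by rewrite e1 mul1r.
Qed.

(** The new diagonal value is (a^2 + b^2) A + 2ab B, and the new mixed value is e (2ab A + (a^2 +
    b^2) B). If A and B agree up to a sign, so do these, the new sign being the old one times e. *)
Lemma sff_null_change X1 X2 Y1 Y2 :
  orthonormal_tangent_basis x p X1 X2 -> orthonormal_tangent_basis x p Y1 Y2 ->
  sff x p X2 X2 = sff x p X1 X1 ->
  sff x p X1 X1 = sff x p X1 X2 \/ sff x p X1 X1 = - sff x p X1 X2 ->
  sff x p Y1 Y1 = sff x p Y1 Y2 \/ sff x p Y1 Y1 = - sff x p Y1 Y2.
Proof.
move=> bX bY E; have [a [b [e [_ e1 -> ->]]]] := orthonormal_basis_change bX bY.
rewrite scalerDr !scalerA !sff_lincomb E.
move: (sff x p X1 X1) (sff x p X1 X2) => P Q.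
have : e = 1 \/ e = - 1.
  by move/eqP: e1; rewrite sqrf_eq1 => /orP[] /eqP->; [left|right].
case=> ->; case=> ->; [left|right|right|left];
  by apply/rowP => i; rewrite !mxE; ring.
Qed.

End SecondFundamentalForm.

(** * Isothermal coordinates *)

Section DoubleVectors.
Variables (R : realType) (n : nat).

Lemma dnum_sum (I : finType) (F G : I -> R) :
  \sum_i Dnum (F i) (G i) = Dnum (\sum_i F i) (\sum_i G i).
Proof. by elim/big_rec3: _ => // i a b _ _ ->. Qed.

Lemma mdot_dnum (a b : 'rV[R]_n) :
  let t := map2_mx (@Dnum R) a b in
  mdot t t = Dnum (mdot a a + mdot b b) (2 * mdot a b).
Proof.
rewrite /= !mdotE mulr_sumr -big_split -dnum_sum; apply: eq_bigr => i _.
by rewrite !mxE; case: ifP => _; congr Dnum => /=; ring.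
Qed.

Lemma mulmx_dnum (a b : 'rV[R]_n) (P : 'M[R]_n) :
  map2_mx (@Dnum R) a b *m map_mx (@dnum_of R) P =
  map2_mx (@Dnum R) (a *m P) (b *m P).
Proof.
apply/rowP => i; rewrite !mxE -dnum_sum; apply: eq_bigr => k _; rewrite !mxE.
by congr Dnum => /=; ring.
Qed.

Lemma scale_half_dnum (a b c d : 'rV[R]_n) :
  dnum_of 2^-1 *: (map2_mx (@Dnum R) a b + dj R *: map2_mx (@Dnum R) c d) =
  map2_mx (@Dnum R) (2^-1 *: (a + d)) (2^-1 *: (b + c)).
Proof. by apply/rowP => i; rewrite !mxE; congr Dnum => /=; ring. Qed.

Lemma Phi'E (y : 'rV[R]_2 -> 'rV[R]_n) s :
  Phi' y s = map2_mx (@Dnum R)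
    (2^-1 *: ('D_(e_u R) ('D_(e_u R) y) s + 'D_(e_v R) ('D_(e_v R) y) s))
    (2^-1 *: ('D_(e_u R) ('D_(e_v R) y) s + 'D_(e_v R) ('D_(e_u R) y) s)).
Proof.
have hre : (fun q => map_mx (@dre R) (Phi y q)) = 'D_(e_u R) y.
  by apply/funext => q; rewrite PhiE; apply/rowP => j; rewrite !mxE.
have him : (fun q => map_mx (@Defs.dim R) (Phi y q)) = 'D_(e_v R) y.
  by apply/funext => q; rewrite PhiE; apply/rowP => j; rewrite !mxE.
by rewrite /Phi' /d_dt /dderive hre him scale_half_dnum.
Qed.

Lemma half_sum_mulmx_dnum (a b c d A B : 'rV[R]_n) (P : 'M[R]_n) :
  a *m P = A -> d *m P = A -> b *m P = B -> c *m P = B ->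
  map2_mx (@Dnum R) (2^-1 *: (a + d)) (2^-1 *: (b + c)) *m
    map_mx (@dnum_of R) P = map2_mx (@Dnum R) A B.
Proof.
move=> aP dP bP cP; rewrite mulmx_dnum -!scalemxAl !mulmxDl aP bP cP dP.
have half (z : 'rV[R]_n) : 2^-1 *: (z + z) = z.
  by apply/rowP => i; rewrite !mxE; field.
by rewrite !half.
Qed.

(** The first two hypotheses will come from minimality together with the isothermal scaling, the
    last two from the symmetry of sigma. *)
Lemma dperp_Phi' (y : 'rV[R]_2 -> 'rV[R]_n) s (A B : 'rV[R]_n) :
  perp y s ('D_(e_u R) ('D_(e_u R) y) s) = A ->
  perp y s ('D_(e_v R) ('D_(e_v R) y) s) = A ->
  perp y s ('D_(e_u R) ('D_(e_v R) y) s) = B ->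
  perp y s ('D_(e_v R) ('D_(e_u R) y) s) = B ->
  dperp y s (Phi' y s) = map2_mx (@Dnum R) A B.
Proof.
rewrite /perp => uu vv uv vu; rewrite /dperp Phi'E.
exact: half_sum_mulmx_dnum uu vv uv vu.
Qed.

End DoubleVectors.

Lemma orthonormal_row_free (R : realType) (n : nat) (Y1 Y2 : 'rV[R]_n) :
  mdot Y1 Y1 = -1 -> mdot Y2 Y2 = 1 -> mdot Y1 Y2 = 0 ->
  row_free (col_mx Y1 Y2).
Proof.
move=> n1 n2 n12; apply: inj_row_free => v.
rewrite -(hsubmxK v) mul_row_col.
rewrite (mx11_scalar (lsubmx v)) (mx11_scalar (rsubmx v)) !mul_scalar_mx => ab.
have m0 z : mdot 0 z = 0 :> R by rewrite /mdot !mul0mx mxE.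
have := congr1 (fun z => mdot z Y1) ab; have := congr1 (fun z => mdot z Y2) ab.
rewrite !m0 !mdot_simp (mdotC Y2) n1 n2 n12.
rewrite !mulr0 add0r addr0 mulr1 mulrN1 => -> /eqP.
by rewrite oppr_eq0 => /eqP->; rewrite !raddf0 row_mx0.
Qed.

(** Since the squares of [a] and [b] are opposite, one factor normalizes both. [J] is left arbitrary
    because the same pair must span the row spaces of two Jacobians. *)
Lemma conformal_normalize (R : realType) (n : nat) (a b : 'rV[R]_n) :
  mdot a a = - mdot b b -> mdot a b = 0 -> mdot a a < 0 ->
  exists2 k : R, 0 < k &
    [/\ forall J : 'M[R]_(2, n), (a <= J)%MS -> (b <= J)%MS ->
          (col_mx (k *: a) (k *: b) == J)%MS,
        mdot (k *: a) (k *: a) = -1, mdot (k *: b) (k *: b) = 1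
      & mdot (k *: a) (k *: b) = 0].
Proof.
move=> EG F E0; pose k := (Num.sqrt (- mdot a a))^-1.
have k0 : 0 < k by rewrite invr_gt0 sqrtr_gt0 oppr_gt0.
have kE : k ^+ 2 * mdot a a = -1.
  rewrite exprVn sqr_sqrtr ?oppr_ge0 ?ltW// invrN mulNr mulVf//.
  by rewrite lt_eqF.
exists k => //.
have n1 : mdot (k *: a) (k *: a) = -1 by rewrite !mdot_simp mulrA -expr2.
have n2 : mdot (k *: b) (k *: b) = 1.
  by rewrite !mdot_simp mulrA -expr2 -[mdot b b]opprK -EG mulrN kE opprK.
have n12 : mdot (k *: a) (k *: b) = 0 by rewrite !mdot_simp F !mulr0.
split=> // J aJ bJ; have free := orthonormal_row_free n1 n2 n12.
have sJ : (col_mx (k *: a) (k *: b) <= J)%MS.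
  by rewrite -addsmxE addsmx_sub !scalemx_sub.
(* Two independent vectors in the row space of a matrix with two rows span it. *)
by rewrite -(geq_leqif (mxrank_leqif_eq sJ)) (eqP free) rank_leq_row.
Qed.

(** The factorization of the squared norm turns membership in [D0] into isotropy of A - B or of A +
    B; the two hypotheses stand for positive definiteness of the normal space. *)
Lemma D0_mdot_dnum (R : realType) (n : nat) (A B : 'rV[R]_n) :
  (mdot (A - B) (A - B) = 0 -> A - B = 0) ->
  (mdot (A + B) (A + B) = 0 -> A + B = 0) ->
  let t := map2_mx (@Dnum R) A B in D0 (mdot t t) <-> A = B \/ A = - B.
Proof.
move=> isoB isoD; rewrite /D0 /= mdot_dnum /dsqnorm /=.
have -> : (mdot A A + mdot B B) ^+ 2 - (2 * mdot A B) ^+ 2 =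
    mdot (A - B) (A - B) * mdot (A + B) (A + B).
  by rewrite !mdot_simp (mdotC B A); ring.
have m0 : mdot (0 : 'rV[R]_n) 0 = 0 by rewrite /mdot !mul0mx mxE.
split=> [/eqP|[] ->]; last 2 first.
- by rewrite subrr m0 mul0r.
- by rewrite addNr m0 mulr0.
rewrite mulf_eq0 => /orP[] /eqP; first by move=> /isoB/subr0_eq; left.
by move=> /isoD/eqP; rewrite addr_eq0 => /eqP; right.
Qed.

Section Isothermal.
Variables (R : realType) (n : nat) (D : set 'rV[R]_2).
Variables (x : 'rV[R]_2 -> 'rV[R]_n) (p : 'rV[R]_2).
Hypotheses (oD : open D) (x2 : Ck 2 D x) (Dp : D p).
Hypothesis rx : row_free ('J x p).
Variables (D' : set 'rV[R]_2) (psi : 'rV[R]_2 -> 'rV[R]_2) (s : 'rV[R]_2).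
Hypotheses (oD' : open D') (psi2 : Ck 2 D' psi).
Hypotheses (psiD : forall q, D' q -> D (psi q)) (D's : D' s) (psis : psi s = p).
Let y := x \o psi.
Hypothesis iso : isothermal D' y.

Lemma derive_reparam w : 'D_w y s = 'D_w psi s *m 'J x p.
Proof.
have dx := x2.1 p Dp; rewrite derive_comp; [|exact: psi2.1|by rewrite psis].
by rewrite psis deriveEjacobian.
Qed.

Lemma tcoord_reparam w : tcoord x p ('D_w y s) = 'D_w psi s.
Proof. by rewrite derive_reparam /tcoord mulmxKp. Qed.

Lemma isothermal_basis : exists2 k : R, 0 < k &
  orthonormal_tangent_basis y s (k *: 'D_(e_u R) y s) (k *: 'D_(e_v R) y s) /\
  orthonormal_tangent_basis x p (k *: 'D_(e_u R) y s) (k *: 'D_(e_v R) y s).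
Proof.
have [EG F E0] := iso D's.
have [k k0 [full n1 n2 n12]] := conformal_normalize EG F E0.
have dy : differentiable y s.
  by apply: differentiable_comp; [exact: psi2.1|rewrite psis; exact: x2.1].
exists k; first exact: k0.
split; split; [|exact: n1|exact: n2|exact: n12| |exact: n1|exact: n2|exact: n12].
  by apply: full; rewrite (deriveEjacobian _ dy) submxMl.
by apply: full; rewrite derive_reparam submxMl.
Qed.

(** This carries the computation in isothermal coordinates back to the given parametrization: the
    second-order chain rule differs from a second derivative of [x] by a tangent vector only. *)
Lemma perp_derive2_reparam w w' :
  perp y s ('D_w' ('D_w y) s) = sff x p ('D_w' y s) ('D_w y s).
Proof.
have [k _ [bys bxp]] := isothermal_basis.
have -> a : perp y s a = perp x p a by rewrite (perpE bys) (perpE bxp).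
rewrite (derive2_comp oD x2 _ _ oD' psi2)// psis /perp mulmxDl -!/(perp x p _).
rewrite (perp_tangent bxp) ?add0r; last by rewrite /tangent submxMl.
by rewrite (sffE oD x2 Dp ('D_w' y s) ('D_w y s)) (tcoord_reparam w')
  (tcoord_reparam w).
Qed.

(** The basis is the normalized isothermal frame, and its scaling cancels from both the diagonal
    equality and the null condition. One basis is enough, as [sff_null_change] reaches the
    others. *)
Lemma degenerateP : exists X1 X2 : 'rV[R]_n,
  orthonormal_tangent_basis x p X1 X2 /\
  (sff x p X2 X2 = sff x p X1 X1 -> (degenerate y s <->
   (sff x p X1 X1 = sff x p X1 X2 \/ sff x p X1 X1 = - sff x p X1 X2))).
Proof.
have [k k0 [bys bxp]] := isothermal_basis.
exists (k *: 'D_(e_u R) y s), (k *: 'D_(e_v R) y s); split; first exact: bxp.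
pose A := sff x p ('D_(e_u R) y s) ('D_(e_u R) y s).
pose B := sff x p ('D_(e_u R) y s) ('D_(e_v R) y s).
pose C := sff x p ('D_(e_v R) y s) ('D_(e_v R) y s).
have kn0 : k != 0 by rewrite gt_eqF.
move=> H0; have CA : C = A by exact: (sffZZ_eq oD x2 Dp _ _ _ _ kn0).1 H0.
have nullE : sff x p (k *: 'D_(e_u R) y s) (k *: 'D_(e_u R) y s) =
      sff x p (k *: 'D_(e_u R) y s) (k *: 'D_(e_v R) y s) \/
    sff x p (k *: 'D_(e_u R) y s) (k *: 'D_(e_u R) y s) =
      - sff x p (k *: 'D_(e_u R) y s) (k *: 'D_(e_v R) y s) <->
    A = B \/ A = - B.
  have E1 := sffZZ_eq oD x2 Dp ('D_(e_u R) y s) ('D_(e_u R) y s)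
    ('D_(e_u R) y s) ('D_(e_v R) y s) kn0.
  have E2 := sffZZ_eqN oD x2 Dp ('D_(e_u R) y s) ('D_(e_u R) y s)
    ('D_(e_u R) y s) ('D_(e_v R) y s) kn0.
  by split; case=> H; [left; exact: (E1.1 H)|right; exact: (E2.1 H)
    |left; exact: (E1.2 H)|right; exact: (E2.2 H)].
have dE : dperp y s (Phi' y s) = map2_mx (@Dnum R) A B.
  have uu := perp_derive2_reparam (e_u R) (e_u R).
  have vv := perp_derive2_reparam (e_v R) (e_v R).
  have uv := perp_derive2_reparam (e_v R) (e_u R).
  have vu := perp_derive2_reparam (e_u R) (e_v R).
  have BC := sffC oD x2 Dp ('D_(e_v R) y s) ('D_(e_u R) y s).
  exact: dperp_Phi' uu (etrans vv CA) uv (etrans vu BC).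
have iso0 t := @sff_lincomb_isotropic _ _ _ _ _ oD x2 Dp _ _ bxp t
  ('D_(e_u R) y s) ('D_(e_u R) y s) ('D_(e_u R) y s) ('D_(e_v R) y s).
apply: iff_trans (iff_sym nullE); rewrite /degenerate dE; apply: D0_mdot_dnum.
- by have := iso0 (-1); rewrite scaleN1r.
- by have := iso0 1; rewrite scale1r.
Qed.

End Isothermal.

Theorem proposition6p4 (R : realType) (n : nat)
    (D : set 'rV[R]_2) (x : 'rV[R]_2 -> 'rV[R]_n) (p : 'rV[R]_2)
    (hM : timelike_surface D x) (hmin : minimal D x) (hp : D p) :
  (* 1 <-> 2, in whatever isothermal coordinates around p *)
  (forall (D' : set 'rV[R]_2) (psi : 'rV[R]_2 -> 'rV[R]_2) (s : 'rV[R]_2),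
      local_reparametrization D D' psi ->
      isothermal D' (x \o psi) ->
      D' s -> psi s = p ->
      (degenerate (x \o psi) s <->
       (forall X1 X2 : 'rV[R]_n, orthonormal_tangent_basis x p X1 X2 ->
          sff x p X1 X1 = sff x p X1 X2 \/
          sff x p X1 X1 = - sff x p X1 X2))) /\
  (* 2 <-> 3 *)
  ((forall X1 X2 : 'rV[R]_n, orthonormal_tangent_basis x p X1 X2 ->
      sff x p X1 X1 = sff x p X1 X2 \/
      sff x p X1 X1 = - sff x p X1 X2) <->
   (exists X1 X2 : 'rV[R]_n, orthonormal_tangent_basis x p X1 X2 /\
      (sff x p X1 X1 = sff x p X1 X2 \/
       sff x p X1 X1 = - sff x p X1 X2))).
Proof.
have [[oD _ _] /(_ 2) x2 /(_ p hp) rx _] := hM.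
(* This basis also serves as the witness for the implication from 2 to 3. *)
have [X1 [X2 [bX H0]]] := hmin p hp.
have E12 : sff x p X2 X2 = sff x p X1 X1.
  move/eqP: H0; rewrite eq_sym scaler_eq0 invr_eq0 pnatr_eq0 /= addrC subr_eq0.
  by move/eqP.
have diag Y1 Y2 (bY : orthonormal_tangent_basis x p Y1 Y2) :=
  sff_eq_diag oD x2 hp bX bY E12.
have change Y1 Y2 Z1 Z2 (bY : orthonormal_tangent_basis x p Y1 Y2)
    (bZ : orthonormal_tangent_basis x p Z1 Z2) :=
  sff_null_change oD x2 hp bY bZ (diag _ _ bY).
split; last first.
  split=> [H|[Y1 [Y2 [bY H]]] Z1 Z2 bZ]; last exact: change bY bZ H.
  by exists X1, X2; split; [exact: bX|exact: H].
move=> D' psi s [[oD' _ _] /(_ 2) psi2 [U [phi [[_ UD] _ psiU _]]]] iso D's psis.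
have psiD q : D' q -> D (psi q) by move=> /psiU[/UD].
(* Degeneracy is tested in the isothermal frame; [change] then transports the null condition to an
   arbitrary basis. *)
have [Y1 [Y2 [bY HY]]] := degenerateP oD x2 hp rx oD' psi2 psiD D's psis iso.
have {}HY := HY (diag _ _ bY).
split=> [/HY H Z1 Z2 bZ|H]; first exact: change bY bZ H.
by apply/HY; exact: H.
Qed.
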